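(* Let $m,n\ge1$ be integers. The multigraph $C_{m\times n}$ supports a tour that realizes a generator if and only if none of the following hold: (i) $m\in\{1,2,4\}$; (ii) $m$ is even and $n$ is odd.
   Context: A knight pair is an ordered pair of integers $(x,y)$ with $\{|x|,|y|\}=\{1,2\}$. For positive integers $m,n$, the multigraph $C_{m\times n}$ has vertex set $\{(a,b)\in\mathbb{Z}^2 : 0\le a\le m-1,\ 0\le b\le n-1\}$. A cylindrical jump is a knight pair $(x,y)$ together with a vertex $(a,b)$ such that $0\le a+x\le m-1$; it joins $(a,b)$ to $(a+x,(b+y)\bmod n)$. The jumps $(x,y),(a,b)$ and $(-x,-y),(a+x,(b+y)\bmod n)$ are declared equivalent, and $C_{m\times n}$ has exactly one edge for each equivalence class (parallel edges may occur). Let $C$ be the cylinder obtained from $[0,m]\times\mathbb{R}$ by identifying $(s,u)$ with $(s,u+n)$, with base point $c=(1/2,1/2)$. Define $j_c$ sending vertex $(a,b)$ to $(a+1/2,b+1/2)$ and the edge given by the jump $(x,y),(a,b)$ to the path $t\mapsto (a+1/2+xt,\,(b+1/2+yt)\bmod n)$, $t\in[0,1]$. A tour on $C_{m\times n}$ is a Hamiltonian cycle based at $(0,0)$: if $mn=1$ it is the constant loop at $(0,0)$; otherwise a cyclic sequence $(0,0)=v_0,\dots,v_{mn-1}$ listing every vertex exactly once, with pairwise distinct edges $e_0,\dots,e_{mn-1}$, $e_i$ joining $v_i$ and $v_{i+1}$ (indices mod $mn$). Traversing $j_c(e_0),\dots,j_c(e_{mn-1})$ in order gives a loop in $C$ based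 at $c$. The tour realizes a generator if this loop is homotopic (rel basepoint) to $\gamma(t)=(1/2,(1/2+nt)\bmod n)$, $t\in[0,1]$, or to its reverse, i.e. it represents a generator of $\pi_1(C,c)\cong\mathbb{Z}$. $C_{m\times n}$ supports such a tour if some tour on it realizes a generator. *)

(* Defs.v *)
From mathcomp Require Import all_boot all_order all_algebra generic_quotient.
From mathcomp Require Import zify lra.
From mathcomp Require Import boolp classical_sets functions set_interval reals.
From mathcomp Require Import topology normedtype.
Import Order.TTheory GRing.Theory Num.Theory.
Import numFieldNormedType.Exports.

Set Implicit Arguments.
Unset Strict Implicit.
Unset Printing Implicit Defensive.

Local Open Scope classical_set_scope.
Local Open Scope ring_scope.
Local Open Scope quotient_scope.

Definition knight (v : int * int) : bool :=
  ((`|v.1| == 1) && (`|v.2| == 2)) || ((`|v.1| == 2) && (`|v.2| == 1)).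

Definition vertex (m n : nat) : Type := ('I_m * 'I_n)%type.

Definition is_jump (m n : nat) (p : (int * int) * ('I_m * 'I_n)) : bool :=
  knight p.1 && (0 <= (p.2.1 : nat)%:Z + p.1.1 <= m%:Z - 1).

Definition jump (m n : nat) : Type :=
  {p : (int * int) * ('I_m * 'I_n) | is_jump p}.

Section Jumps.
Variables m n : nat.
Implicit Type j : jump m n.

Definition jdir j : int * int := (val j).1.
Definition jsrc j : vertex m n := (val j).2.

Lemma jtgt_subproof1 j : (absz (((jsrc j).1 : nat)%:Z + (jdir j).1)%R < m)%N.
Proof. case: j => -[[x y] [a b]] /= /andP[_]; rewrite /jsrc /jdir /=; lia. Qed.

Lemma jtgt_subproof2 j :
  (absz ((((jsrc j).2 : nat)%:Z + (jdir j).2)%R %% n%:Z)%Z < n)%N.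
Proof.
have n0 : (0 < n)%N by exact: leq_ltn_trans (ltn_ord (jsrc j).2).
have nz : n%:Z != 0 by lia.
have := modz_ge0 (((jsrc j).2 : nat)%:Z + (jdir j).2) nz.
have := ltz_mod (((jsrc j).2 : nat)%:Z + (jdir j).2) nz.
lia.
Qed.

(* The absolute values only turn nonnegative integers into naturals. *)
Definition jtgt j : vertex m n :=
  (Ordinal (jtgt_subproof1 j), Ordinal (jtgt_subproof2 j)).

Lemma jrev_subproof j : is_jump (- (jdir j).1, - (jdir j).2, jtgt j).
Proof.
case: j => -[[x y] [a b]] /= h.
rewrite /is_jump /knight /jtgt /jsrc /jdir /= !normrN.
case/andP: h => + /= hx; rewrite /knight /= => -> /=.
by have := ltn_ord a; move: hx; lia.
Qed.

Definition jrev j : jump m n :=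
  exist (@is_jump m n) _ (jrev_subproof j).

Lemma jtgt_rev j : jtgt (jrev j) = jsrc j.
Proof.
case: j => -[[x y] [a b]] /= h; congr pair; apply: val_inj => /=;
  rewrite /jsrc /jdir /=.
- by move: h => /andP[_] /= ?; have := ltn_ord a; lia.
- have n0 : (0 < n)%N by exact: leq_ltn_trans (ltn_ord b).
  have nz : n%:Z != 0 by lia.
  rewrite gez0_abs ?modz_ge0// modzDml addrK.
  by rewrite modz_small//; have := ltn_ord b; lia.
Qed.

Lemma jrevK : involutive jrev.
Proof.
move=> j; apply: val_inj => /=; rewrite jtgt_rev /jdir /= !opprK.
by rewrite -!surjective_pairing.
Qed.

Definition jump_equiv : rel (jump m n) := fun j k => (k == j) || (k == jrev j).

Lemma jump_equiv_refl : reflexive jump_equiv.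
Proof. by move=> j; rewrite /jump_equiv eqxx. Qed.

Lemma jump_equiv_sym : symmetric jump_equiv.
Proof.
move=> j k; rewrite /jump_equiv [k == j]eq_sym; congr orb.
by apply/eqP/eqP => ->; rewrite jrevK.
Qed.

Lemma jump_equiv_trans : transitive jump_equiv.
Proof.
move=> k j l /orP[] /eqP -> /orP[] /eqP ->; rewrite /jump_equiv ?jrevK ?eqxx//.
all: by rewrite orbT.
Qed.

Canonical jump_equiv_equiv :=
  EquivRel jump_equiv jump_equiv_refl jump_equiv_sym jump_equiv_trans.

Definition edge : Type := {eq_quot jump_equiv}.

Definition edge_of j : edge := \pi_{eq_quot jump_equiv} j.

Definition at_origin (v : vertex m n) : bool :=
  ((v.1 : nat) == 0%N) && ((v.2 : nat) == 0%N).

(* A closed walk is given by the jumps [js] followed by it: the edge e_i from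
   v_i to v_(i+1) is represented by the one of its two jumps that starts at
   v_i.  When m n = 1 the only tour is the constant one, the empty sequence. *)
Definition is_tour (js : seq (jump m n)) : Prop :=
  if (m * n == 1)%N then js = [::] else
  [/\ (exists j js', js = j :: js' /\ at_origin (jsrc j)),
      perm_eq (map jsrc js) (enum {: 'I_m * 'I_n}),
      cycle (fun j k => jtgt j == jsrc k) js
    & uniq (map edge_of js)].

End Jumps.

Section Cylinder.
Variables (R : realType) (m n : nat).

Definition strip : set (R * R) := [set p | 0 <= p.1 <= m%:R].

Definition cyl_equiv : rel (set_type strip) := fun p q =>
  `[< (val p).1 = (val q).1 /\
      exists k : int, (val q).2 = (val p).2 + k%:~R * n%:R >].

Lemma cyl_equiv_refl : reflexive cyl_equiv.
Proof. by move=> p; apply/asboolP; split=> //; exists 0; rewrite mul0r addr0. Qed.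

Lemma cyl_equiv_sym : symmetric cyl_equiv.
Proof.
suff h p q : cyl_equiv p q -> cyl_equiv q p by move=> p q; apply/idP/idP; exact: h.
move=> /asboolP[e [k qE]]; apply/asboolP; split=> //; exists (- k).
by rewrite qE mulrNz mulNr addrK.
Qed.

Lemma cyl_equiv_trans : transitive cyl_equiv.
Proof.
move=> q p r /asboolP[e [k qE]] /asboolP[e' [l rE]]; apply/asboolP.
by split; [rewrite e | exists (k + l); rewrite rE qE intrD mulrDl addrA].
Qed.

Canonical cyl_equiv_equiv :=
  EquivRel cyl_equiv cyl_equiv_refl cyl_equiv_sym cyl_equiv_trans.

Definition cylinder : Type := quotient_topology {eq_quot cyl_equiv}.

Lemma strip0 : (0, 0) \in strip.
Proof. by rewrite inE /strip /= lexx ler0n. Qed.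

(* The class of (s, u).  The value outside the strip is a dummy: by
   [strip_base] and [strip_jc] below, it is never used. *)
Definition cyl_point (s u : R) : cylinder :=
  \pi_{eq_quot cyl_equiv} (insubd (SigSub strip0 : set_type strip) (s, u)).

Definition cyl_base : cylinder := cyl_point (1 / 2) (1 / 2).

(* The reduction mod n of the second coordinate is absorbed by the quotient. *)
Definition jc (j : jump m n) (t : R) : cylinder :=
  cyl_point ((jsrc j).1%:R + 1 / 2 + (jdir j).1%:~R * t)
            ((jsrc j).2%:R + 1 / 2 + (jdir j).2%:~R * t).

Definition gen_loop (t : R) : cylinder := cyl_point (1 / 2) (1 / 2 + n%:R * t).

Lemma strip_base u : (0 < m)%N -> strip (1 / 2, u).
Proof.
move=> m0; rewrite /strip /=.
have : (1 : R) <= m%:R by rewrite ler1n.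
by move=> ?; apply/andP; split; lra.
Qed.

Lemma strip_jc (j : jump m n) (t u : R) : 0 <= t <= 1 ->
  strip ((jsrc j).1%:R + 1 / 2 + (jdir j).1%:~R * t, u).
Proof.
case: j => -[[x y] [a b]] /= /andP[_ /=] h t01.
rewrite /strip /jsrc /jdir /=; case/andP: h => h1 h2.
have a1 : (a : nat)%:R + 1 <= m%:R :> R by rewrite natr1 ler_nat ltn_ord.
have a0 : 0 <= (a : nat)%:R :> R by rewrite ler0n.
have : (0 : R) <= ((a : nat)%:Z + x)%:~R by rewrite ler0z.
have : ((a : nat)%:Z + x)%:~R <= (m%:Z - 1)%:~R :> R by rewrite ler_int.
rewrite !intrD /= => h3 h4.
have -> : (a : nat)%:R + 1 / 2 + x%:~R * t =
  (1 - t) * (a : nat)%:R + t * ((a : nat)%:R + x%:~R) + 1 / 2 :> R by lra.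
by apply/andP; split; nra.
Qed.

Lemma cyl_point_eq (s u u' : R) (k : int) :
  strip (s, u) -> u' = u + k%:~R * n%:R -> cyl_point s u = cyl_point s u'.
Proof.
move=> su uE; apply/eqmodP; apply/asboolP.
by rewrite !insubdK ?inE//; split=> //; exists k.
Qed.

(* The two jumps of an edge give mutually reverse paths. *)
Lemma jc_rev (j : jump m n) (t : R) : 0 <= t <= 1 ->
  jc (jrev j) t = jc j (1 - t).
Proof.
move=> t01.
have E1 : (jsrc (jrev j)).1%:R = (jsrc j).1%:R + (jdir j).1%:~R :> R.
  have -> : (jsrc (jrev j)).1 = (jtgt j).1 by [].
  have h : (((jtgt j).1 : nat)%:Z) = ((jsrc j).1 : nat)%:Z + (jdir j).1.
    rewrite /= gez0_abs//; case: (j) => -[[x y] [a b]] /= /andP[_ /=].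
    by rewrite /jsrc /jdir /= => /andP[].
  by rewrite -[LHS]/((((jtgt j).1 : nat)%:Z)%:~R) h intrD.
have [k E2] : exists k : int, (jsrc (jrev j)).2%:R =
    (jsrc j).2%:R + (jdir j).2%:~R + k%:~R * n%:R :> R.
  have -> : (jsrc (jrev j)).2 = (jtgt j).2 by [].
  have n0 : (0 < n)%N by exact: leq_ltn_trans (ltn_ord (jsrc j).2).
  have nz : n%:Z != 0 by lia.
  set z := ((jsrc j).2 : nat)%:Z + (jdir j).2.
  exists (- (z %/ n%:Z)%Z).
  have h : ((jtgt j).2 : nat)%:Z = z - (z %/ n%:Z)%Z * n%:Z.
    by rewrite /= gez0_abs ?modz_ge0.
  by rewrite -[LHS]/((((jtgt j).2 : nat)%:Z)%:~R) h intrB intrM intrD mulrNz mulNr.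
rewrite /jc E1 [(jdir (jrev j)).1]/= [(jdir (jrev j)).2]/= !mulrNz E2.
have -> : (jsrc j).1%:R + (jdir j).1%:~R + 1 / 2 + - (jdir j).1%:~R * t =
  (jsrc j).1%:R + 1 / 2 + (jdir j).1%:~R * (1 - t) :> R by lra.
apply/esym; apply: (@cyl_point_eq _ _ _ k); last by lra.
by apply: strip_jc; apply/andP; split; lra.
Qed.

End Cylinder.

Section Homotopy.
Variables (R : realType) (T : topologicalType).

Definition path_rev (p : R -> T) : R -> T := fun t => p (1 - t).

Definition path_concat (p q : R -> T) : R -> T :=
  fun t => if t <= 1 / 2 then p (2 * t) else q (2 * t - 1).

(* p, then p_1, ..., then p_k, where ps = [:: p_1; ...; p_k]. *)
Fixpoint path_concats (p : R -> T) (ps : seq (R -> T)) : R -> T :=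
  if ps is q :: ps' then path_concat p (path_concats q ps') else p.

(* Homotopy, rel base point, of loops [0, 1] -> T based at c. *)
Definition loop_homotopic (c : T) (f g : R -> T) : Prop :=
  exists H : R * R -> T,
    [/\ {within (`[0, 1] `*` `[0, 1] : set (R * R)), continuous H},
        (forall t : R, 0 <= t <= 1 -> H (t, 0) = f t),
        (forall t : R, 0 <= t <= 1 -> H (t, 1) = g t)
      & (forall s : R, 0 <= s <= 1 -> H (0, s) = c /\ H (1, s) = c)].

End Homotopy.

Section Tours.
Variables (R : realType) (m n : nat).

Definition tour_loop (js : seq (jump m n)) : R -> cylinder R m n :=
  if js is j :: js' then path_concats (@jc R m n j) (map (@jc R m n) js')
  else fun=> cyl_base R m n.

Definition realizes_generator (js : seq (jump m n)) : Prop :=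
  loop_homotopic (cyl_base R m n) (tour_loop js) (@gen_loop R m n) \/
  loop_homotopic (cyl_base R m n) (tour_loop js) (path_rev (@gen_loop R m n)).

Definition supports_generator_tour : Prop :=
  exists js : seq (jump m n), is_tour js /\ realizes_generator js.

End Tours.

(* Main.v *)
(* Lifting a tour to the strip [0,m] x R, its loop is homotopic to a generator
   exactly when its vertical displacements sum to n or -n: equal displacements
   give a straight-line homotopy, and conversely summing centered height
   differences over a fine grid shows that a homotopy preserves the total
   displacement.
   Obstructions: each jump changes the sum of coordinates by an odd number, so
   n = mn mod 2; for m = 2 and n even the parity of the second coordinate is
   constant; for m = 4 and n even a tour alternates between inner and outer
   rows as well as between colours, hence cannot reach outer vertices of both
   colours.
   Existence: a lifted tour from (0,0) to (0,p) on the m by p cylinder, repeated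
   q times, is a tour on the m by pq cylinder.  For m odd take p = 1, for m even
   take p = 2, starting from explicit tours with m = 3 and m = 6; replacing a
   jump u -> u + (-1,2) from the top row by u -> u + (2,1) -> u + (1,3) ->
   u + (-1,2) adds two rows. *)
Require Import Defs.
From mathcomp Require Import all_boot reals.
From mathcomp Require Import all_order all_algebra generic_quotient zify ring lra.
From mathcomp Require Import boolp classical_sets set_interval.
From mathcomp Require Import topology normedtype.
Import Order.TTheory GRing.Theory Num.Theory.
Import numFieldNormedType.Exports.

Set Implicit Arguments.
Unset Strict Implicit.
Unset Printing Implicit Defensive.

(** * Homotopy invariance of the total height *)

Section Winding.
Local Open Scope classical_set_scope.
Local Open Scope ring_scope.
Local Open Scope quotient_scope.

(** The Lebesgue number of a compact set. A point within [r / 2] of [x] and another within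
    [d < r / 2] of the first both lie in [ball x r], and near-covering compactness makes the choice
    of [d] uniform. *)
Lemma compact_uniform_near (R : realType) (X : pseudoMetricType R) (K : set X)
    (Q : X -> X -> Prop) :
  compact K ->
  (forall x, K x -> exists2 U, nbhs x U &
     forall y z, U y -> U z -> K y -> K z -> Q y z) ->
  exists2 d : R, 0 < d & forall y z, K y -> K z -> ball y d z -> Q y z.
Proof.
move=> /compact_near_coveringP/near_covering_withinP cK KQ.
have := cK R 0^'+ (fun d y => forall z, K z -> ball y d z -> Q y z) _.
have cov x : K x -> \forall y \near x & d \near 0^'+, K y ->
    forall z, K z -> ball y d z -> Q y z.
  move=> Kx; have [U /nbhs_ballP[r /= r0 rU] UQ] := KQ _ Kx.
  have r2 : 0 < r / 2 by rewrite divr_gt0.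
  exists (ball x (r / 2), [set d : R | d < r / 2]).
    by split => /=; [exact: nbhsx_ballx | exact: nbhs_right_lt].
  move=> [y d] /= [xy dr] Ky z Kz yz; apply: UQ => //; apply: rU.
    by apply: le_ball xy; lra.
  by rewrite [r]splitr; apply: (ball_triangle xy); apply: le_ball yz; exact: ltW.
move=> /(_ _ cov) fin.
near (0 : R)^'+ => d; exists d => //.
by move=> y z Ky Kz yz; have /(_ y Ky z Kz yz) : K `<=` (fun y =>
  forall z, K z -> ball y d z -> Q y z) by near: d.
Unshelve. all: by end_near. Qed.

(* The representative of [x] mod [n] in [[-n/2, n/2)]. *)
Definition centered (R : realType) (n x : R) : R :=
  x - (Num.floor (x / n + 1 / 2))%:~R * n.

Lemma centered_small (R : realType) (n x : R) (k : int) : 0 < n ->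
  `|x - k%:~R * n| < n / 2 -> centered n x = x - k%:~R * n.
Proof.
move=> n0 xk; rewrite /centered (@floor_def _ _ k)// intrD.
have -> : x / n = (x - k%:~R * n) / n + k%:~R by field; lra.
move: xk; rewrite ltr_norml => /andP[h1 h2].
have h3 : - (1 / 2) < (x - k%:~R * n) / n by rewrite ltr_pdivlMr//; lra.
have h4 : (x - k%:~R * n) / n < 1 / 2 by rewrite ltr_pdivrMr//; lra.
by apply/andP; split; lra.
Qed.

(** Both sides are lifts of [c - a] modulo [n], so they differ by a multiple of [n]; four terms
    below [n / 4] in absolute value leave only zero. *)
Lemma centered_square (R : realType) (n a b c d : R) : 0 < n ->
  `|centered n (b - a)| < n / 4 -> `|centered n (c - b)| < n / 4 ->
  `|centered n (c - d)| < n / 4 -> `|centered n (d - a)| < n / 4 ->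
  centered n (b - a) + centered n (c - b) =
  centered n (d - a) + centered n (c - d).
Proof.
move=> n0; rewrite !ltr_norml => /andP[h1 h2] /andP[h3 h4] /andP[h5 h6] /andP[h7 h8].
apply/eqP; rewrite -subr_eq0; apply/eqP.
have : exists k : int, centered n (b - a) + centered n (c - b) -
    (centered n (d - a) + centered n (c - d)) = k%:~R * n.
  rewrite /centered; set p := Num.floor _; set q := Num.floor _.
  set r := Num.floor _; set s := Num.floor _.
  by exists (- p - q + r + s); rewrite !(intrD, mulrNz); ring.
case=> k kE; rewrite kE.
have [k1 k2] : k%:~R * n < 1 * n /\ -1 * n < k%:~R * n by rewrite -kE; lra.
rewrite !ltr_pM2r // in k1 k2.
rewrite (_ : 1 = 1%:~R)// ltr_int in k1.
rewrite (_ : -1 = (-1)%:~R)// ltr_int in k2.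
have -> : k = 0 by lia.
by rewrite mul0r.
Qed.

(** Each cell is a [centered_square], so passing from row [j] to row [j.+1] changes the horizontal
    sum by a telescoping sum of vertical increments. What is left are the increments at the two
    sides, which vanish because [A] is constant there. *)
Lemma centered_grid (R : realType) (n : R) (N : nat) (A : nat -> nat -> R) :
  0 < n ->
  (forall i j, (i < N)%N -> (j <= N)%N ->
    `|centered n (A i.+1 j - A i j)| < n / 4) ->
  (forall i j, (i <= N)%N -> (j < N)%N ->
    `|centered n (A i j.+1 - A i j)| < n / 4) ->
  (forall j, (j <= N)%N -> A 0%N j = A 0%N 0%N) ->
  (forall j, (j <= N)%N -> A N j = A N 0%N) ->
  \sum_(i < N) centered n (A i.+1 N - A i N) =
  \sum_(i < N) centered n (A i.+1 0%N - A i 0%N).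
Proof.
move=> n0 Ah Av A0 AN.
suff H j : (j <= N)%N -> \sum_(i < N) centered n (A i.+1 j - A i j) =
    \sum_(i < N) centered n (A i.+1 0%N - A i 0%N) by exact: H.
elim: j => // j IH jN; rewrite -(IH (ltnW jN)); apply/eqP; rewrite -subr_eq0.
rewrite -sumrB -(big_mkord xpredT (fun i => centered n (A i.+1 j.+1 - A i j.+1) -
  centered n (A i.+1 j - A i j))).
rewrite (@eq_big_nat _ _ _ _ _ _ (fun i => centered n (A i.+1 j.+1 - A i.+1 j) -
  centered n (A i j.+1 - A i j))).
  by rewrite telescope_sumr// !A0 ?AN ?subrr// ltnW.
move=> i /andP[_ iN].
have := @centered_square R n (A i j) (A i.+1 j) (A i.+1 j.+1) (A i j.+1) n0
  (Ah _ _ iN (ltnW jN)) (Av _ _ iN jN) (Ah _ _ iN jN) (Av _ _ (ltnW iN) jN).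
lra.
Qed.

(** [repr] picks an arbitrary sheet, so this function need not be continuous and is meaningful only
    modulo [n]. *)
Definition height (R : realType) (m n : nat) (p : cylinder R m n) : R :=
  (val (repr p)).2.

Lemma height_pi (R : realType) (m n : nat) (w : set_type (@strip R m)) :
  exists k : int,
    height (\pi_(cylinder R m n) w) = (val w).2 + k%:~R * n%:R.
Proof.
have : repr (\pi_{eq_quot (@cyl_equiv R m n)} w) = w
  %[mod {eq_quot (@cyl_equiv R m n)}] by rewrite reprK.
by move=> /eqmodP; rewrite /= equiv_sym => /asboolP[_ ?].
Qed.

Lemma height_cyl_point (R : realType) (m n : nat) (p : R * R) :
  @strip R m p ->
  exists k : int, height (cyl_point m n p.1 p.2) = p.2 + k%:~R * n%:R.
Proof.
move=> sp; rewrite /cyl_point.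
have [k kE] := @height_pi R m n (insubd (SigSub (@strip0 R m) : set_type (@strip R m)) (p.1, p.2)).
by exists k; move: kE; rewrite insubdK ?inE//; case: p sp.
Qed.

(** Continuity of the height modulo [n]: the preimage in the strip is a union of open bands, one for
    each integer translate. *)
Lemma height_near_open (R : realType) (m n : nat) (h e : R) :
  open [set p : cylinder R m n | exists k : int, `|height p - h + k%:~R * n%:R| < e].
Proof.
rewrite /open /= /quotient_open.
have -> : \pi_(cylinder R m n) @^-1` [set p : cylinder R m n | exists k : int,
    `|height p - h + k%:~R * n%:R| < e] =
  (fun w : set_type (@strip R m) => (val w).2) @^-1`
    (\bigcup_(k : int) ball (h - k%:~R * n%:R) e).
  apply/seteqP; split=> w /=; have [l lE] := @height_pi R m n w; rewrite lE.
    move=> [k kE]; exists (l + k) => //; rewrite /ball /= distrC.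
    by move: kE; congr (`| _ | < _); rewrite intrD; ring.
  move=> [k _]; rewrite /ball /= distrC => kE; exists (k - l).
  by move: kE; congr (`| _ | < _); rewrite intrB; ring.
apply: open_comp; last by apply: bigcup_open => k _; exact: ball_open.
move=> w _; apply: (@continuous_comp _ _ _ (val : set_type (@strip R m) -> R * R) snd).
  exact: initial_continuous.
exact: cvg_snd.
Qed.

(** The homotopy itself is not lifted: its heights modulo [n] are taken at the points of a fine
    grid, and [centered_grid] compares the bottom edge, lifted by [P], with the top edge, lifted by
    [Q]. *)
Lemma homotopic_lift_height (R : realType) (m n : nat) (c : cylinder R m n)
    (f g : R -> cylinder R m n) (P Q : R -> R * R) :
  (0 < n)%N -> loop_homotopic c f g -> continuous P -> continuous Q ->
  (forall t, 0 <= t <= 1 -> @strip R m (P t) /\ f t = cyl_point m n (P t).1 (P t).2) ->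
  (forall t, 0 <= t <= 1 -> @strip R m (Q t) /\ g t = cyl_point m n (Q t).1 (Q t).2) ->
  (P 1).2 - (P 0).2 = (Q 1).2 - (Q 0).2.
Proof.
move=> n0 [H [Hc Hf Hg Hb]] Pc Qc Pf Qg.
have nR : 0 < n%:R :> R by rewrite ltr0n.
have liftU (F : R -> R * R) : continuous F -> exists2 d : R, 0 < d &
    forall y z : R, `[0, 1]%classic y -> `[0, 1]%classic z -> ball y d z ->
    `|(F z).2 - (F y).2| < n%:R / 4.
  move=> Fc; apply: compact_uniform_near; first exact: segment_compact.
  move=> x _; exists [set y | `|(F x).2 - (F y).2| < n%:R / 8].
    have Fx : (fun y => (F y).2) @ x --> (F x).2.
      by apply: (@continuous_comp _ _ _ F snd); [exact: Fc | exact: cvg_snd].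
    by have /cvgrPdist_lt := Fx; apply; rewrite divr_gt0.
  move=> y z /= + + _ _; rewrite !ltr_norml => /andP[? ?] /andP[? ?].
  by apply/andP; split; lra.
have [d1 d10 Pd] := liftU P Pc.
have [d2 d20 Qd] := liftU Q Qc.
have [d3 d30 Hd] : exists2 d : R, 0 < d & forall y z : R * R, (`[0, 1] `*` `[0, 1])%classic y ->
    (`[0, 1] `*` `[0, 1])%classic z -> ball y d z ->
    `|centered n%:R (height (H z) - height (H y))| < n%:R / 4.
  apply: compact_uniform_near; first by apply: compact_setX; exact: segment_compact.
  (* Two heights within [n / 8] of that of [H x], up to multiples of [n], differ by less than
     [n / 4] modulo [n], as [centered_square] demands. *)
  move=> x Kx; set V := [set p : cylinder R m n |
    exists k : int, `|height p - height (H x) + k%:~R * n%:R| < n%:R / 8].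
  have /(_ x Kx)/(_ V) := (subspace_continuousP _ _).1 Hc.
  have Vx : nbhs (H x) V.
    apply: open_nbhs_nbhs; split; first exact: height_near_open.
    by exists 0; rewrite subrr mul0r addr0 normr0 divr_gt0.
  move=> /(_ Vx) HV; eexists; first exact: HV.
  move=> y z /= Hy Hz Ky Kz; have [k kE] := Hy Ky; have [l lE] := Hz Kz.
  have kl : `|height (H z) - height (H y) - (k - l)%:~R * n%:R| < n%:R / 4.
    rewrite intrB; move: kE lE; rewrite !ltr_norml => /andP[? ?] /andP[? ?].
    by apply/andP; split; lra.
  by rewrite (@centered_small _ _ _ (k - l))//; lra.
pose d := Num.min d1 (Num.min d2 d3).
have d0 : 0 < d by rewrite !lt_min d10 d20.
have [dd1 dd2 dd3] : [/\ d <= d1, d <= d2 & d <= d3].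
  by rewrite !ge_min !lexx !orbT.
pose N := (Num.truncn d^-1).+1.
have N0 : 0 < N%:R :> R by rewrite ltr0n.
have Nd : N%:R^-1 < d.
  by rewrite invf_plt ?posrE// truncnS_gt.
pose x i : R := i%:R / N%:R.
have x01 i : (i <= N)%N -> 0 <= x i <= 1.
  by move=> iN; rewrite divr_ge0// ler_pdivrMr// mul1r ler_nat.
have xI i : (i <= N)%N -> `[0, 1]%classic (x i) by move=> iN; rewrite /= in_itv/= x01.
have x0 : x 0%N = 0 by rewrite /x mul0r.
have xN : x N = 1 by rewrite /x divff// gt_eqF.
have xS i : ball (x i) d (x i.+1).
  rewrite /ball /= distrC /x -mulrBl -natr1 addrAC subrr add0r mul1r ger0_norm//.
  by rewrite invr_ge0 ltW.
pose A i j := height (H (x i, x j)).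
(* Along an edge with a continuous lift, the small increments of the lift are the centered
   differences, so they telescope to its total rise. *)
have lift_sum (F : R -> R * R) f0 (B : nat -> R) :
    (forall t, 0 <= t <= 1 -> @strip R m (F t) /\ f0 t = cyl_point m n (F t).1 (F t).2) ->
    (forall i, (i < N)%N -> `|(F (x i.+1)).2 - (F (x i)).2| < n%:R / 4) ->
    (forall i, (i <= N)%N -> B i = height (f0 (x i))) ->
    \sum_(i < N) centered n%:R (B i.+1 - B i) = (F 1).2 - (F 0).2.
  move=> Ff Fd BE; rewrite -[in RHS]xN -[in RHS]x0.
  rewrite -(@telescope_sumr _ 0%N N (fun i => (F (x i)).2))//.
  rewrite big_mkord; apply: eq_bigr => -[i iN] _ /=; rewrite !BE ?(ltnW iN)//.
  have [s1 ->] := Ff _ (x01 _ iN); have [s2 ->] := Ff _ (x01 _ (ltnW iN)).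
  have [k ->] := @height_cyl_point R m n _ s1.
  have [l ->] := @height_cyl_point R m n _ s2.
  have klE : (F (x i.+1)).2 + k%:~R * n%:R - ((F (x i)).2 + l%:~R * n%:R) -
    (k - l)%:~R * n%:R = (F (x i.+1)).2 - (F (x i)).2 by rewrite intrB; ring.
  by rewrite (@centered_small _ _ _ (k - l)) ?klE//; have := Fd _ iN; lra.
have SQ : \sum_(i < N) centered n%:R (A i.+1 N - A i N) = (Q 1).2 - (Q 0).2.
  apply: (lift_sum Q g (fun i => A i N)) => // i iN; last by rewrite /A xN Hg// x01.
  by apply: Qd; [exact/xI/ltnW|exact: xI|exact: le_ball (xS i)].
have SP : \sum_(i < N) centered n%:R (A i.+1 0%N - A i 0%N) = (P 1).2 - (P 0).2.
  apply: (lift_sum P f (fun i => A i 0%N)) => // i iN; last by rewrite /A x0 Hf// x01.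
  by apply: Pd; [exact/xI/ltnW|exact: xI|exact: le_ball (xS i)].
rewrite -SP -SQ; apply/esym/centered_grid => //.
- move=> i j iN jN; apply: Hd.
  + by split; [exact/xI/ltnW|exact: xI].
  + by split; exact: xI.
  + by split; [exact: le_ball (xS i)|exact: ballxx].
- move=> i j iN jN; apply: Hd.
  + by split; [exact: xI|exact/xI/ltnW].
  + by split; exact: xI.
  + by split; [exact: ballxx|exact: le_ball (xS j)].
- move=> j jN; rewrite /A x0; have [-> _] := Hb _ (x01 _ jN).
  by have := Hb _ (x01 0%N isT); rewrite x0 => -[-> _].
- by move=> j jN; rewrite /A xN; have [_ ->] := Hb _ (x01 _ jN); have [_ ->] := Hb _ (x01 0%N isT).
Qed.
End Winding.

(** * Lifting the loop of a tour *)

Section Lifting.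
Local Open Scope classical_set_scope.
Local Open Scope ring_scope.
Local Open Scope quotient_scope.

Lemma pair_continuous (T U V : topologicalType) (f : T -> U) (g : T -> V) :
  continuous f -> continuous g -> continuous (fun x => (f x, g x)).
Proof.
move=> fc gc x; apply: (@cvg_pair _ _ _ (nbhs x) (nbhs (f x)) (nbhs (g x))).
- exact: fc.
- exact: gc.
Qed.

Lemma clamp_strip (R : realType) (m : nat) (p : R * R) :
  (Num.max 0 (Num.min p.1 m%:R), p.2) \in @strip R m.
Proof. by rewrite inE /strip /= le_max lexx ge_max ler0n ge_min lexx orbT. Qed.

(** [cyl_point] jumps to a dummy value outside the strip. Clamping the first coordinate extends the
    projection continuously to the whole plane. *)
Definition clamp_proj (R : realType) (m n : nat) (p : R * R) : cylinder R m n :=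
  \pi_(cylinder R m n) (SigSub (clamp_strip m p) : set_type (@strip R m)).

Lemma clamp_projE (R : realType) (m n : nat) (p : R * R) :
  @strip R m p -> clamp_proj m n p = cyl_point m n p.1 p.2.
Proof.
move=> sp; rewrite /clamp_proj /cyl_point; congr (\pi _); apply: val_inj => /=.
rewrite insubdK ?inE; last by case: p sp.
by have /andP[p0 pm] : 0 <= p.1 <= m%:R := sp; rewrite (min_idPl pm) (max_idPr p0).
Qed.

Lemma clamp_proj_continuous (R : realType) (m n : nat) :
  continuous (@clamp_proj R m n).
Proof.
move=> p; apply: (@continuous_comp _ _ _
  (fun p => SigSub (clamp_strip m p) : set_type (@strip R m))); last first.
  exact: pi_continuous.
apply: (@continuous_comp_initial _ _ _ (val : set_type (@strip R m) -> R * R)).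
rewrite (_ : _ \o _ = fun q : R * R => (Num.max 0 (Num.min q.1 m%:R), q.2))//.
apply: pair_continuous => q; last exact: cvg_snd.
apply: (@continuous_max _ _ (fun=> 0) (fun q : R * R => Num.min q.1 m%:R)).
  exact: cvg_cst.
by apply: (@continuous_min _ _ fst (fun=> m%:R)); [exact: cvg_fst|exact: cvg_cst].
Qed.

(** The straight-line homotopy between the lifts is projected to the cylinder; the common endpoints
    of [P] and [Q] keep it at [c] on both sides. *)
Lemma lifts_homotopic (R : realType) (m n : nat) (c : cylinder R m n)
    (f g : R -> cylinder R m n) (P Q : R -> R * R) :
  continuous P -> continuous Q ->
  (forall t, 0 <= t <= 1 -> @strip R m (P t) /\ f t = cyl_point m n (P t).1 (P t).2) ->
  (forall t, 0 <= t <= 1 -> @strip R m (Q t) /\ g t = cyl_point m n (Q t).1 (Q t).2) ->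
  P 0 = Q 0 -> P 1 = Q 1 -> f 0 = c -> f 1 = c ->
  loop_homotopic c f g.
Proof.
move=> Pc Qc Pf Qg PQ0 PQ1 f0 f1.
pose K (z : R * R) : R * R := P z.1 + z.2 *: (Q z.1 - P z.1).
have K0 t : K (t, 0) = P t by rewrite /K scale0r addr0.
have K1 t : K (t, 1) = Q t by rewrite /K scale1r addrC subrK.
exists (fun z => clamp_proj m n (K z)); split.
- apply: continuous_subspaceT => z; apply: continuous_comp; last exact: clamp_proj_continuous.
  have cfst (F : R -> R * R) : continuous F -> (F z.1) @[z --> z] --> F z.1.
    by move=> Fc; apply: (@continuous_comp _ _ _ fst F); [exact: cvg_fst|exact: Fc].
  apply: cvgD; first exact: cfst.
  by apply: cvgZ; [exact: cvg_snd|apply: cvgB; exact: cfst].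
- by move=> t t01; have [s ->] := Pf t t01; rewrite K0 clamp_projE.
- by move=> t t01; have [s ->] := Qg t t01; rewrite K1 clamp_projE.
- have le01 : 0 <= (0 : R) <= 1 by rewrite lexx ler01.
  have le11 : 0 <= (1 : R) <= 1 by rewrite ler01 lexx.
  move=> s _; split; rewrite /K /= -?PQ0 -?PQ1 subrr scaler0 addr0.
    by have [s0 fE] := Pf _ le01; rewrite clamp_projE// -fE.
  by have [s1 fE] := Pf _ le11; rewrite clamp_projE// -fE.
Qed.

Lemma path_concat_continuous (R : realType) (p q : R -> R * R) :
  continuous p -> continuous q -> p 1 = q 0 -> continuous (path_concat p q).
Proof.
move=> pc qc pq.
(* This closed form replaces a gluing argument: on each half one path moves while the other is
   frozen at the junction [p 1 = q 0]. *)
have -> : path_concat p q =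
    (fun t => p (Num.min (2 * t) 1) + q (Num.max (2 * t - 1) 0) - p 1).
  apply/funext => t; rewrite /path_concat; case: ifP => t2.
    have -> : Num.min (2 * t) 1 = 2 * t by apply/min_idPl; lra.
    have -> : Num.max (2 * t - 1) 0 = 0 by apply/max_idPr; lra.
    by rewrite -pq addrK.
  have -> : Num.min (2 * t) 1 = 1 by apply/min_idPr; lra.
  have -> : Num.max (2 * t - 1) 0 = 2 * t - 1 by apply/max_idPl; lra.
  by rewrite addrAC subrr add0r.
have c2 : continuous (fun t : R => 2 * t) by exact: mulrl_continuous.
move=> t; apply: cvgB; last exact: cvg_cst.
apply: cvgD.
  apply: (@continuous_comp _ _ _ (fun t : R => Num.min (2 * t) 1) p); last exact: pc.
  apply: (@continuous_min _ _ (fun t : R => 2 * t) (fun=> 1)); first exact: c2.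
  exact: cvg_cst.
apply: (@continuous_comp _ _ _ (fun t : R => Num.max (2 * t - 1) 0) q); last exact: qc.
apply: (@continuous_max _ _ (fun t : R => 2 * t - 1) (fun=> 0)).
  by apply: cvgB; [exact: c2|exact: cvg_cst].
exact: cvg_cst.
Qed.

Lemma segment_continuous (R : realType) (a b c d : R) :
  continuous (fun t => (a + b * t, c + d * t)).
Proof.
apply: pair_continuous => t; apply: cvgD; try exact: cvg_cst.
all: exact: mulrl_continuous.
Qed.

Lemma jtgt1E (m n : nat) (j : jump m n) :
  ((jtgt j).1 : nat)%:Z = ((jsrc j).1 : nat)%:Z + (jdir j).1.
Proof.
rewrite /= gez0_abs//; case: j => -[[x y] [a b]] /= /andP[_ /=].
by rewrite /jsrc /jdir /= => /andP[].
Qed.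

Lemma jtgt2E (m n : nat) (j : jump m n) :
  exists k : int, ((jtgt j).2 : nat)%:Z = ((jsrc j).2 : nat)%:Z + (jdir j).2 + k * n%:Z.
Proof.
have n0 : (0 < n)%N by exact: leq_ltn_trans (ltn_ord (jsrc j).2).
exists (- ((((jsrc j).2 : nat)%:Z + (jdir j).2) %/ n%:Z)%Z).
by rewrite /= gez0_abs ?modz_ge0//; [rewrite {2}(divz_eq (_ + _) n%:Z) mulNr; lia|lia].
Qed.

Lemma jump_lift (R : realType) (m n : nat) (j : jump m n) (h k : int) :
  h = ((jsrc j).2 : nat)%:Z + k * n%:Z ->
  exists P : R -> R * R, [/\ continuous P,
    P 0 = ((jsrc j).1%:R + 1 / 2, h%:~R + 1 / 2),
    P 1 = ((jtgt j).1%:R + 1 / 2, (h + (jdir j).2)%:~R + 1 / 2) &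
    forall t, 0 <= t <= 1 -> @strip R m (P t) /\
      jc j t = cyl_point m n (P t).1 (P t).2].
Proof.
move=> hE; exists (fun t => ((jsrc j).1%:R + 1 / 2 + (jdir j).1%:~R * t,
  h%:~R + 1 / 2 + (jdir j).2%:~R * t)); split.
- exact: segment_continuous.
- by rewrite !mulr0 !addr0.
- rewrite -[(jtgt j).1%:R]/((((jtgt j).1 : nat)%:Z)%:~R) jtgt1E !intrD !mulr1.
  by rewrite addrAC [X in (_, X)]addrAC.
- move=> t t01; split; first exact: strip_jc.
  rewrite /jc; apply: (@cyl_point_eq _ _ _ _ _ _ k); first exact: strip_jc.
  by rewrite hE intrD intrM /=; ring.
Qed.

(** The start is allowed on any sheet [k], since after one jump the lift need no longer lie on the
    sheet of the reduced vertex. *)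
Lemma tour_loop_lift_from (R : realType) (m n : nat) (j : jump m n) (js : seq (jump m n))
    (h k : int) :
  path (fun j k => jtgt j == jsrc k) j js ->
  h = ((jsrc j).2 : nat)%:Z + k * n%:Z ->
  exists P : R -> R * R, [/\ continuous P,
    P 0 = ((jsrc j).1%:R + 1 / 2, h%:~R + 1 / 2),
    P 1 = ((jtgt (last j js)).1%:R + 1 / 2,
           (h + \sum_(i <- j :: js) (jdir i).2)%:~R + 1 / 2) &
    forall t, 0 <= t <= 1 -> @strip R m (P t) /\
      tour_loop (j :: js) t = cyl_point m n (P t).1 (P t).2].
Proof.
elim: js j h k => [|j' js IH] j h k; first by rewrite big_seq1 => _; exact: jump_lift.
move=> /= /andP[/eqP jj' jjs] hE.
have [l lE] := jtgt2E j.
have h'E : h + (jdir j).2 = ((jsrc j').2 : nat)%:Z + (k - l) * n%:Z.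
  by rewrite hE -jj' lE mulrBl; ring.
have [P [Pc P0 P1 Pjs]] := IH _ _ _ jjs h'E.
have [S [Sc S0 S1 Sj]] := @jump_lift R _ _ _ _ _ hE.
exists (path_concat S P); split.
- by apply: path_concat_continuous; rewrite ?S1 ?P0 ?jj'.
- by rewrite /path_concat mulr0 divr_ge0// S0.
- rewrite /path_concat mulr1 ifF; last by lra.
  have -> : 2 - 1 = 1 :> R by lra.
  by rewrite P1 big_cons [in RHS]addrA.
- move=> t t01; rewrite /path_concat; case: ifP => t2; [apply: Sj|apply: Pjs]; lra.
Qed.

Lemma tour_loop_lift (R : realType) (m n : nat) (js : seq (jump m n)) :
  is_tour js -> exists P : R -> R * R, [/\ continuous P,
    P 0 = (1 / 2, 1 / 2),
    P 1 = (1 / 2, (\sum_(i <- js) (jdir i).2)%:~R + 1 / 2) &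
    (0 < m)%N -> forall t, 0 <= t <= 1 -> @strip R m (P t) /\
      tour_loop js t = cyl_point m n (P t).1 (P t).2].
Proof.
have triv : [::] = js -> exists P : R -> R * R, [/\ continuous P,
    P 0 = (1 / 2, 1 / 2),
    P 1 = (1 / 2, (\sum_(i <- js) (jdir i).2)%:~R + 1 / 2) &
    (0 < m)%N -> forall t, 0 <= t <= 1 -> @strip R m (P t) /\
      tour_loop js t = cyl_point m n (P t).1 (P t).2].
  move=> <-; exists (fun=> (1 / 2, 1 / 2)); rewrite big_nil add0r; split=> //.
    by move=> t; exact: cvg_cst.
  by move=> m0 t _; split => //; exact: strip_base.
rewrite /is_tour; case: ifP => _; first by move=> jsE; apply: triv.
case=> -[j [js' [jsE /andP[/eqP j1 /eqP j2]]]] _ + _.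
rewrite jsE /= rcons_path => /andP[jjs /eqP lastE].
have h0 : 0 = ((jsrc j).2 : nat)%:Z + 0 * n%:Z by rewrite j2 mul0r.
have [P [Pc P0 P1 Pj]] := @tour_loop_lift_from R _ _ _ _ _ _ jjs h0.
exists P; split => //; first by rewrite P0 j1 !add0r.
by rewrite P1 lastE j1 !add0r.
Qed.

Lemma realizes_generatorP (R : realType) (m n : nat) (js : seq (jump m n)) :
  (0 < m)%N -> (0 < n)%N -> is_tour js ->
  realizes_generator R js <->
  \sum_(j <- js) (jdir j).2 = n%:Z \/ \sum_(j <- js) (jdir j).2 = - n%:Z.
Proof.
move=> m0 n0 tjs; have [P [Pc P0 P1 /(_ m0) Pjs]] := tour_loop_lift R tjs.
set y := \sum_(j <- js) _ in P1 *.
pose G (t : R) : R * R := (1 / 2, 1 / 2 + n%:R * t).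
have Gc : continuous G.
  apply: pair_continuous => t; first exact: cvg_cst.
  by apply: cvgD; [exact: cvg_cst|exact: mulrl_continuous].
have Gg t : 0 <= t <= 1 -> @strip R m (G t) /\
    gen_loop m n t = cyl_point m n (G t).1 (G t).2.
  by move=> _; split => //; exact: strip_base.
pose G' (t : R) : R * R := (1 / 2, 1 / 2 - n%:R * t).
have G'c : continuous G'.
  apply: pair_continuous => t; first exact: cvg_cst.
  by apply: cvgB; [exact: cvg_cst|exact: mulrl_continuous].
have G'g t : 0 <= t <= 1 -> @strip R m (G' t) /\
    path_rev (gen_loop m n) t = cyl_point m n (G' t).1 (G' t).2.
  move=> _; split; first exact: strip_base.
  (* The formula for [path_rev] starts at height [1 / 2 + n]; [G'] starts one turn lower, where the
     lift of the tour starts. *)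
  apply: (@cyl_point_eq _ _ _ _ _ _ (-1)); first exact: strip_base.
  by rewrite /=; ring.
have le01 : 0 <= (0 : R) <= 1 by rewrite lexx ler01.
have le11 : 0 <= (1 : R) <= 1 by rewrite ler01 lexx.
have js0 : tour_loop js 0 = cyl_base R m n.
  by have [_ ->] := Pjs _ le01; rewrite P0.
split.
  case=> hom; [left|right]; apply/eqP; rewrite -(eqr_int R); apply/eqP.
    have := homotopic_lift_height n0 hom Pc Gc Pjs Gg.
    rewrite P0 P1 /G /= mulr1 mulr0; lra.
  have := homotopic_lift_height n0 hom Pc G'c Pjs G'g.
  rewrite P0 P1 /G' /= mulr1 mulr0 mulrNz; lra.
(* A total rise divisible by [n] makes the loop end at the base point, as [lifts_homotopic]
   requires. *)
have js1 (k : int) : y = k * n%:Z -> tour_loop js 1 = cyl_base R m n.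
  move=> yE; have [_ ->] := Pjs _ le11; rewrite P1 /=.
  apply/esym/(@cyl_point_eq _ _ _ _ _ _ k); first exact: strip_base.
  by rewrite yE intrM addrC.
case=> yE; [left|right].
  apply: (lifts_homotopic Pc Gc Pjs Gg) => //.
  - by rewrite P0 /G mulr0 addr0.
  - by rewrite P1 /G mulr1 yE addrC.
  - by apply: (js1 1); rewrite mul1r.
apply: (lifts_homotopic Pc G'c Pjs G'g) => //.
- by rewrite P0 /G' mulr0 subr0.
- by rewrite P1 /G' mulr1 yE mulrNz addrC.
- by apply: (js1 (-1)); rewrite mulN1r.
Qed.
End Lifting.

(** * Construction of the tours *)

Section Construction.
Local Open Scope ring_scope.

Definition knight_step (u v : int * int) : bool :=
  knight (v.1 - u.1, v.2 - u.2).

(** The projection from the universal cover to the vertices. The row is reduced modulo [m] to make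
    the function total, and is kept when it lies in range. *)
Definition vertex_at (m n : nat) (hm : (0 < m)%N) (hn : (0 < n)%N) (p : int * int) :
    vertex m n :=
  (Ordinal (ltn_pmod `|p.1| hm), Ordinal (ltn_pmod `|(p.2 %% n%:Z)%Z| hn)).

Lemma vertex_at_row (m n : nat) (hm : (0 < m)%N) (hn : (0 < n)%N) (p : int * int) :
  0 <= p.1 < m%:Z -> (((vertex_at hm hn p).1 : nat) : int) = p.1.
Proof. by move=> pm; rewrite /= modn_small; lia. Qed.

Lemma vertex_at_col (m n : nat) (hm : (0 < m)%N) (hn : (0 < n)%N) (p : int * int) :
  (((vertex_at hm hn p).2 : nat) : int) = (p.2 %% n%:Z)%Z.
Proof.
have nz : n%:Z != 0 by lia.
have := modz_ge0 p.2 nz; have := ltz_mod p.2 nz.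
by move=> /= ? ?; rewrite modn_small; lia.
Qed.

Lemma vertex_at_jump (m n : nat) (hm : (0 < m)%N) (hn : (0 < n)%N) (p q : int * int) :
  0 <= p.1 < m%:Z -> 0 <= q.1 < m%:Z -> knight_step p q ->
  is_jump ((q.1 - p.1, q.2 - p.2), vertex_at hm hn p).
Proof.
move=> pm qm pq; apply/andP; split; first exact: pq.
by have /= -> := vertex_at_row hm hn pm; lia.
Qed.

Lemma jtgt_vertex_at (m n : nat) (hm : (0 < m)%N) (hn : (0 < n)%N) (p q : int * int)
    (h : is_jump ((q.1 - p.1, q.2 - p.2), vertex_at hm hn p)) :
  0 <= p.1 < m%:Z -> 0 <= q.1 < m%:Z ->
  jtgt (exist (@is_jump m n) _ h) = vertex_at hm hn q.
Proof.
move=> pm qm; set j := exist _ _ _; congr pair; apply: val_inj.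
  rewrite /j /jtgt /jsrc /jdir [LHS]/=; have /= -> := vertex_at_row hm hn pm.
  by rewrite addrC subrK modn_small; lia.
rewrite /j /jtgt /jsrc /jdir [LHS]/=; have /= -> := vertex_at_col hm hn p.
rewrite modzDml addrC subrK modn_small//.
have nz : n%:Z != 0 by lia.
by have := modz_ge0 q.2 nz; have := ltz_mod q.2 nz; lia.
Qed.

(** [w] is a walk in the universal cover. Counting shows that one period visits every vertex exactly
    once, and the rise of its jumps telescopes to [n]. *)
Lemma tour_of_walk (R : realType) (m n : nat) (w : nat -> int * int) :
  (0 < m)%N -> (0 < n)%N -> (2 < m * n)%N ->
  w 0%N = (0, 0) -> w (m * n)%N = (0, n%:Z) ->
  (forall i, 0 <= (w i).1 < m%:Z) -> (forall i, knight_step (w i) (w i.+1)) ->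
  (forall a b, (a < m)%N -> (b < n)%N -> exists2 i, (i < m * n)%N &
     (w i).1 = a%:Z /\ ((w i).2 = b%:Z %[mod n])%Z) ->
  supports_generator_tour R m n.
Proof.
move=> hm hn mn2 w0 wN wrow wstep wcov.
set N := (m * n)%N in mn2 wN wcov *.
pose v i := vertex_at hm hn (w i).
pose J i : jump m n := exist (@is_jump m n) _
  (vertex_at_jump hm hn (wrow i) (wrow i.+1) (wstep i)).
have Jsrc i : jsrc (J i) = v i by [].
have Jtgt i : jtgt (J i) = v i.+1 by exact: jtgt_vertex_at.
have vN : v N = v 0%N.
  rewrite /v wN w0; congr pair; apply: val_inj => //=.
  by rewrite modzz mod0z.
have vall u : u \in [seq v i | i <- iota 0 N].
    case: u => a b; have [i iN [wa wb]] := wcov _ _ (ltn_ord a) (ltn_ord b).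
    apply/mapP; exists i; first by rewrite mem_iota.
    have va : (((v i).1 : nat) : int) = a by rewrite vertex_at_row.
    have vb : (((v i).2 : nat) : int) = b.
      by rewrite vertex_at_col wb modz_small//; have := ltn_ord b; lia.
    case: (v i) va vb => a' b' /= [va] [vb].
    by congr pair; exact: val_inj.
(* A list of [m * n] vertices that contains them all has no repetition. *)
have usrc : uniq [seq v i | i <- iota 0 N].
  apply: (@leq_size_uniq _ (enum {: 'I_m * 'I_n})); rewrite ?enum_uniq//.
  by rewrite size_map size_iota -cardE card_prod !card_ord.
have vinj i k : (i < N)%N -> (k < N)%N -> v i = v k -> i = k.
  move=> iN kN vik; apply/eqP.
  rewrite -(nth_uniq (v 0%N) _ _ usrc) ?size_map ?size_iota//.
  by rewrite !(nth_map 0%N) ?size_iota// !nth_iota// vik.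
pose js := [seq J i | i <- iota 0 N].
have tjs : is_tour js.
  rewrite /is_tour ifF; last by apply/negbTE; rewrite -/N; lia.
  have NS : N = (N.-1).+1 by lia.
  split.
  - exists (J 0%N), [seq J i | i <- iota 1 N.-1].
    rewrite /js {1}NS; split=> //.
    by rewrite /at_origin Jsrc /v w0 /= mod0z !mod0n.
  - rewrite -map_comp; apply: uniq_perm; rewrite ?enum_uniq//.
    by move=> u; rewrite mem_enum; apply: vall.
  - have Jpath k l : path (fun j k => jtgt j == jsrc k) (J k) [seq J i | i <- iota k.+1 l].
      by elim: l k => //= l IH k; rewrite Jtgt eqxx IH.
    rewrite /js NS /= rcons_path Jpath /=.
    have -> : last (J 0%N) [seq J i | i <- iota 1 N.-1] = J N.-1.
      rewrite last_map (last_nth 0%N) size_iota -[0%N :: _]/(iota 0 N.-1.+1).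
      by rewrite nth_iota.
    by rewrite Jtgt -NS vN.
  - rewrite -map_comp map_inj_in_uniq ?iota_uniq// => i k.
    rewrite !mem_iota add0n => /= iN kN /eqmodP /= /orP[] /eqP Jik.
      by apply: vinj => //; rewrite -!Jsrc Jik.
    (* If the jumps [i] and [k] are reverse to each other, each index is the cyclic successor of the
       other, which is impossible for [N > 2]. *)
    have vS l : (l < N)%N -> v l.+1 = v (if l.+1 == N then 0%N else l.+1).
      by move=> lN; case: eqP => // ->.
    have slt l : (l < N)%N -> ((if l.+1 == N then 0 else l.+1) < N)%N.
      by move=> lN; case: eqP; lia.
    have := congr1 (@jsrc m n) Jik; have := congr1 (@jtgt m n) Jik.
    have -> : jsrc (jrev (J i)) = v i.+1 by exact: Jtgt.
    rewrite jtgt_rev Jtgt !Jsrc !vS//.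
    move=> e1 e2; have := vinj _ _ (slt _ kN) iN e1; have := vinj _ _ kN (slt _ iN) e2.
    by do 2!case: eqP; lia.
exists js; split=> //; apply/realizes_generatorP => //; left.
rewrite big_map -[N]subn0 -/(index_iota 0 N).
by rewrite telescope_sumr// wN w0 subr0.
Qed.

(* A walk in the universal cover that visits each vertex of the [m] by [p]
   cylinder once, from (0, 0) to its translate (0, p). *)
Definition lifted_tour (m p : nat) (L : seq (int * int)) : Prop :=
  [/\ path knight_step (0, 0) (rcons L (0, p%:Z)),
      all (fun v => 0 <= v.1 < m%:Z) L,
      (size L).+1 = (m * p)%N &
      forall a b : nat, (a < m)%N -> (b < p)%N ->
        has (fun v => (v.1 == a%:Z) && ((v.2 %% p%:Z)%Z == b%:Z)) ((0, 0) :: L)].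

(** Copies of the walk [W] are stacked, copy number [i %/ M] being raised by that many times [p];
    [q] copies rise by [p * q] in all. *)
Lemma lifted_tour_supports (R : realType) (m p q : nat) (L : seq (int * int)) :
  (2 < m)%N -> (0 < p)%N -> (0 < q)%N -> lifted_tour m p L ->
  supports_generator_tour R m (p * q).
Proof.
move=> m2 p0 q0 [Lpath Lrow Lsize Lcov].
set M := (m * p)%N in Lsize.
have M0 : (0 < M)%N by rewrite -Lsize.
pose W := (0, 0) :: L.
pose w i : int * int := ((nth (0, 0) W (i %% M)).1,
  (nth (0, 0) W (i %% M)).2 + (i %/ M)%:Z * p%:Z).
apply: (@tour_of_walk R m (p * q) w).
- lia.
- by rewrite muln_gt0 p0.
- have : (0 < p * q)%N by rewrite muln_gt0 p0.
  by nia.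
- by rewrite /w mod0n div0n mul0r.
- by rewrite /w mulnA -/M modnMr mulKn//= PoszM mulrC add0r.
- move=> i; rewrite /w /=.
  have : all (fun v : int * int => 0 <= v.1 < m%:Z) W by rewrite /= Lrow andbT; lia.
  by move/all_nthP; apply; rewrite /= Lsize ltn_mod.
- move=> i.
  have /(pathP (0, 0))/(_ (i %% M)%N) := Lpath.
  rewrite size_rcons Lsize ltn_mod => /(_ M0).
  have -> : nth (0, 0) ((0, 0) :: rcons L (0, p%:Z)) (i %% M) = nth (0, 0) W (i %% M).
    by rewrite -rcons_cons nth_rcons /= Lsize ltn_mod M0.
  rewrite nth_rcons /knight_step /w.
  have [iM|iM] := ltnP (i %% M) (size L).
    have iMS : ((i %% M).+1 < M)%N by lia.
    have -> : (i.+1 %% M = (i %% M).+1)%N by rewrite -addn1 -modnDml addn1 modn_small.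
    have -> : (i.+1 %/ M = i %/ M)%N.
      by rewrite {1}(divn_eq i M) -addnS divnMDl// [((i %% M).+1 %/ M)%N]divn_small ?addn0.
    by rewrite /= opprD addrACA subrr addr0.
  (* At the end of a copy, the closing step to [(0, p)] becomes the step to the start of the next
     copy. *)
  have iME : (i %% M = size L)%N by apply/eqP; rewrite eqn_leq iM andbT -ltnS Lsize ltn_mod.
  have -> : (i.+1 %% M = 0)%N by rewrite -addn1 -modnDml addn1 iME Lsize modnn.
  have -> : (i.+1 %/ M = (i %/ M).+1)%N.
    by rewrite {1}(divn_eq i M) -addnS divnMDl// iME Lsize divnn M0 addn1.
  rewrite iME eqxx /=; congr knight; congr pair.
  have -> : ((i %/ M).+1)%:Z = (i %/ M)%:Z + 1 by lia.
  ring.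
- move=> a b am bpq.
  have /hasP[v vL /andP[/eqP va /eqP vb]] := Lcov a (b %% p)%N am (ltn_pmod b p0).
  (* The heights [v.2] and [b] agree modulo [p]; [s] is the difference of their quotients, and its
     residue [t] modulo [q] is the copy in which the vertex is met. *)
  pose s := (b %/ p)%N%:Z - (v.2 %/ p%:Z)%Z.
  pose t := (s %% q%:Z)%Z.
  have qz : q%:Z != 0 by lia.
  have t0 : 0 <= t := modz_ge0 s qz.
  have tq : t < `|q%:Z| := ltz_mod s qz.
  have vW : (index v W < M)%N by rewrite -Lsize -[(size L).+1]/(size W) index_mem.
  exists (`|t|%N * M + index v W)%N.
    rewrite mulnA -/M; nia.
  rewrite /w modnMDl modn_small// divnMDl// [(index v W %/ M)%N]divn_small// addn0.
  rewrite nth_index//=; split=> //.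
  apply/eqP; rewrite eqz_mod_dvd; apply/dvdzP; exists (- (s %/ q%:Z)%Z).
  have bE : b%:Z = (b %/ p)%N%:Z * p%:Z + (b %% p)%N%:Z by rewrite {1}(divn_eq b p); lia.
  rewrite bE -vb gez0_abs// {1}(divz_eq v.2 p) PoszM.
  have -> : t = s - (s %/ q%:Z)%Z * q%:Z
    by apply/eqP; rewrite eq_sym subr_eq addrC; apply/eqP/divz_eq.
  by rewrite /s; ring.
Qed.

(** * Two-row extensions of explicit lifted tours *)

(** Applied with [a = m]: the jump from [(a - 1, h)] in the top row to [(a - 2, h + 2)] is rerouted
    through the new rows [a + 1] and [a]. *)
Lemma detour_steps (a h : int) :
  [&& knight_step (a - 1, h) (a + 1, h + 1),
      knight_step (a + 1, h + 1) (a, h + 3) &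
      knight_step (a, h + 3) (a - 2, h + 2)].
Proof.
rewrite /knight_step /=.
have -> : a + 1 - (a - 1) = 2 by ring.
have -> : h + 1 - h = 1 by ring.
have -> : a - (a + 1) = - 1 by ring.
have -> : h + 3 - (h + 1) = 2 by ring.
have -> : a - 2 - a = - 2 by ring.
by have -> : h + 2 - (h + 3) = - 1 by ring.
Qed.

Lemma sub_rows (m : nat) : subpred (fun v : int * int => 0 <= v.1 < m%:Z)
  (fun v : int * int => 0 <= v.1 < m.+2%:Z).
Proof. by move=> [a h] /=; lia. Qed.

Lemma new_rows (m : nat) : (m%:Z + 1 < m.+2%:Z) && (m%:Z < m.+2%:Z).
Proof. by lia. Qed.

(** Modulo [1] a row is a single vertex, so one detour visits both new rows. Its middle jump, from
    row [m + 1] to row [m], is again a jump by [(-1, 2)] from the top row, so the extension can be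
    iterated. *)
Lemma lifted_tour_extend1 (m : nat) (A B : seq (int * int)) (h : int) :
  let L := A ++ [:: (m%:Z - 1, h), (m%:Z - 2, h + 2) & B] in
  let L' := A ++ [:: (m%:Z - 1, h), (m%:Z + 1, h + 1), (m%:Z, h + 3), (m%:Z - 2, h + 2) & B] in
  lifted_tour m 1 L -> lifted_tour m.+2 1 L'.
Proof.
move=> L L' [Lpath Lrow Lsize Lcov]; split.
- move: Lpath; rewrite /L /L' !rcons_cat !cat_path /= => /and4P[-> -> _ ->].
  by have /and3P[-> -> ->] := detour_steps m%:Z h.
- move: Lrow; rewrite /L /L' !all_cat /= => /and4P[hA h1 h2 hB].
  rewrite (sub_all (@sub_rows m) hA) (sub_all (@sub_rows m) hB).
  rewrite (@sub_rows m (_, h) h1) (@sub_rows m (_, h) h2).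
  by have /andP[-> ->] := new_rows m.
- by rewrite muln1 -(muln1 m) -Lsize /L /L' !size_cat /= !addnS.
- move=> a b am; rewrite ltnS leqn0 => /eqP ->.
  have [aM|aM] := ltnP a m.
    move: (Lcov a 0%N aM isT); rewrite /L /L' -!cat_cons !has_cat /=.
    by case/orP=> [/orP[]|/or3P[]] ->; rewrite ?orbT.
  have [aE|aE] : a = m \/ a = m.+1 by lia.
    apply/hasP; exists (m%:Z, h + 3); last by rewrite /= modz1 aE !eqxx.
    by rewrite !(inE, mem_cat) eqxx !orbT.
  apply/hasP; exists (m%:Z + 1, h + 1).
    by rewrite !(inE, mem_cat) eqxx !orbT.
  by rewrite /= modz1 aE eqxx andbT; apply/eqP; lia.
Qed.

Lemma lifted_tour_odd (m : nat) : (2 < m)%N -> odd m -> exists L, lifted_tour m 1 L.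
Proof.
suff H k : exists A B h, lifted_tour k.*2.+3 1
    (A ++ [:: (k.*2.+3%:Z - 1, h), (k.*2.+3%:Z - 2, h + 2) & B]).
  move=> m2 om; have [A [B [h AB]]] := H (m - 3)./2.
  have mE : (m - 3)./2.*2.+3 = m by lia.
  by rewrite mE in AB; eexists; exact: AB.
elim: k => [|k [A [B [h AB]]]].
  (* The walk [(0, 0)], [(2, 1)], [(1, 3)], [(0, 1)] on three rows. *)
  exists [::], [::], 1; split=> //.
  by move=> [|[|[|a]]] [|b].
exists (rcons A (k.*2.+3%:Z - 1, h)), ((k.*2.+3%:Z - 2, h + 2) :: B), (h + 1).
have := lifted_tour_extend1 AB; rewrite cat_rcons doubleS.
congr lifted_tour; congr (A ++ _ :: _ :: _ :: _); congr pair; lia.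
Qed.

(** Modulo [2] each row has two vertices. The marked jumps start at heights of opposite parity, so
    the two detours meet both vertices of each new row. *)
Lemma lifted_tour_extend2 (m : nat) (A B C : seq (int * int)) (h k : int) :
  let L := A ++ [:: (m%:Z - 1, h), (m%:Z - 2, h + 2) &
    B ++ [:: (m%:Z - 1, k), (m%:Z - 2, k + 2) & C]] in
  let L' := A ++ [:: (m%:Z - 1, h), (m%:Z + 1, h + 1), (m%:Z, h + 3), (m%:Z - 2, h + 2) &
    B ++ [:: (m%:Z - 1, k), (m%:Z + 1, k + 1), (m%:Z, k + 3), (m%:Z - 2, k + 2) & C]] in
  ((k - h) %% 2 = 1)%Z -> lifted_tour m 2 L -> lifted_tour m.+2 2 L'.
Proof.
move=> L L' hk [Lpath Lrow Lsize Lcov]; split.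
- move: Lpath; rewrite /L /L' !rcons_cat /= !rcons_cat !cat_path /= !cat_path /=.
  move=> /and5P[-> -> _ -> /and3P[-> _ ->]].
  have /and3P[-> -> ->] := detour_steps m%:Z h.
  by have /and3P[-> -> ->] := detour_steps m%:Z k.
- move: Lrow; rewrite /L /L' !all_cat /= !all_cat /=.
  move=> /and5P[hA h1 h2 hB /and3P[k1 k2 hC]].
  rewrite (sub_all (@sub_rows m) hA) (sub_all (@sub_rows m) hB).
  rewrite (sub_all (@sub_rows m) hC).
  rewrite (@sub_rows m (_, h) h1) (@sub_rows m (_, h) h2).
  by have /andP[-> ->] := new_rows m.
- rewrite (_ : m.+2 * 2 = (m * 2).+4)%N; last by rewrite !mulSn.
  by rewrite -Lsize /L /L' !size_cat /= !size_cat /= !addnS.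
- move=> a b am b2.
  have [aM|aM] := ltnP a m.
    move: (Lcov a b aM b2); rewrite /L /L' /= !has_cat /= !has_cat /=.
    by case/or4P => [|||/or3P[||/or3P[]]] ->; rewrite ?orbT.
  have [l lL lb] : exists2 l, (l == h) || (l == k) & ((l + 1) %% 2 = b%:Z)%Z.
    have [hb|kb] : ((h + 1) %% 2 = b%:Z)%Z \/ ((k + 1) %% 2 = b%:Z)%Z by lia.
      by exists h; rewrite ?eqxx.
    by exists k; rewrite ?eqxx ?orbT.
  have lb3 : ((l + 3) %% 2 = b%:Z)%Z.
    by rewrite -lb (_ : l + 3 = 1 * 2 + (l + 1)) ?modzMDl//; ring.
  have [aE|aE] : a = m \/ a = m.+1 by lia.
    apply/hasP; exists (m%:Z, l + 3); last by rewrite /= lb3 aE !eqxx.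
    by case/orP: lL => /eqP ->; rewrite !(inE, mem_cat) eqxx !orbT.
  apply/hasP; exists (m%:Z + 1, l + 1).
    by case/orP: lL => /eqP ->; rewrite !(inE, mem_cat) eqxx !orbT.
  by rewrite /= lb aE eqxx andbT; apply/eqP; lia.
Qed.

Lemma lifted_tour_even (m : nat) : (4 < m)%N -> ~~ odd m -> exists L, lifted_tour m 2 L.
Proof.
suff H r : exists A B C h k, ((k - h) %% 2 = 1)%Z /\ lifted_tour (r.*2 + 6) 2
    (A ++ [:: ((r.*2 + 6)%N%:Z - 1, h), ((r.*2 + 6)%N%:Z - 2, h + 2) &
     B ++ [:: ((r.*2 + 6)%N%:Z - 1, k), ((r.*2 + 6)%N%:Z - 2, k + 2) & C]]).
  move=> m4 om; have [A [B [C [h [k [_ AB]]]]]] := H (m - 6)./2.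
  have mE : ((m - 6)./2.*2 + 6 = m)%N by lia.
  by rewrite mE in AB; eexists; exact: AB.
elim: r => [|r [A [B [C [h [k [hk AB]]]]]]].
  (* Eleven vertices between [(0, 0)] and [(0, 2)] on six rows; the marked jumps start at [(5, -1)]
     and [(5, -2)]. *)
  exists [:: (1, -2); (2, 0); (0, -1); (1, 1); (3, 0)], [:: (3, -1)], [:: (2, 1)], (-1), (-2).
  split=> //; split=> //.
  by move=> [|[|[|[|[|[|a]]]]]] [|[|b]].
exists (rcons A ((r.*2 + 6)%N%:Z - 1, h)),
  (((r.*2 + 6)%N%:Z - 2, h + 2) :: rcons B ((r.*2 + 6)%N%:Z - 1, k)),
  (((r.*2 + 6)%N%:Z - 2, k + 2) :: C), (h + 1), (k + 1).
split; first by rewrite (_ : k + 1 - (h + 1) = k - h)//; lia.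
have := lifted_tour_extend2 hk AB; rewrite cat_rcons cat_cons cat_rcons doubleS.
have -> : (r.*2.+2 + 6)%N%:Z - 1 = (r.*2 + 6)%N%:Z + 1 by lia.
have -> : (r.*2.+2 + 6)%N%:Z - 2 = (r.*2 + 6)%N%:Z by lia.
by rewrite -!addrA.
Qed.

Lemma supports_of_admissible (R : realType) (m n : nat) : (0 < m)%N -> (0 < n)%N ->
  m \notin [:: 1; 2; 4]%N -> ~~ (~~ odd m && odd n) -> supports_generator_tour R m n.
Proof.
rewrite !inE !negb_or => m0 n0 /and3P[m1 m2 m4] mn.
have [om|em] := boolP (odd m).
  have [|L HL] := lifted_tour_odd _ om; first by case: m m0 m1 m2 {m4 mn} om => [|[|[]]].
  by rewrite -[n]mul1n; apply: lifted_tour_supports HL => //; lia.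
have [|L HL] := lifted_tour_even _ em; first by lia.
have -> : n = (2 * n./2)%N by lia.
by apply: lifted_tour_supports HL => //; lia.
Qed.

End Construction.

(** * Obstructions *)

Section Obstruction.
Local Open Scope ring_scope.

(** The last clause serves to refute a tour by an invariant of its jumps that separates two
    vertices. *)
Lemma tour_jumps (m n : nat) (js : seq (jump m n)) : (m * n != 1)%N -> is_tour js ->
  [/\ size js = (m * n)%N,
      perm_eq [seq jsrc j | j <- js] (enum {: 'I_m * 'I_n}),
      perm_eq [seq jtgt j | j <- js] (enum {: 'I_m * 'I_n}) &
      forall T (f : vertex m n -> T), (forall j, j \in js -> f (jtgt j) = f (jsrc j)) ->
        forall u v, f u = f v].
Proof.
move=> mn1; rewrite /is_tour (negbTE mn1).
case=> -[j [js' [jsE _]]] psrc cyc _.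
have jsz : size js = (m * n)%N.
  by rewrite -(size_map (@jsrc m n)) (perm_size psrc) -cardE card_prod !card_ord.
(* In a closed walk the targets are the sources shifted by one place. *)
have tgt_rot : [seq jtgt j | j <- js] = rot 1 [seq jsrc j | j <- js].
  rewrite -map_rot jsE rot1_cons; move: cyc; rewrite jsE /=.
  elim: js' {1 3}j {jsE jsz psrc} => [|k js' IH] i /=; first by rewrite andbT => /eqP ->.
  by case/andP=> /eqP -> /IH ->.
split=> //.
  by rewrite tgt_rot; apply: perm_trans psrc; rewrite perm_rot.
move=> T f fj.
suff fsrc u : f u = f (jsrc j) by move=> u v; rewrite !fsrc.
have : u \in [seq jsrc j | j <- js] by rewrite (perm_mem psrc) mem_enum.
move: cyc fj; rewrite jsE /= rcons_path => /andP[+ _].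
elim: js' {jsE jsz psrc tgt_rot} j => [|k js' IH] j /=.
  by move=> _ _; rewrite inE => /eqP ->.
case/andP=> /eqP jk kjs fj; rewrite inE => /orP[/eqP -> //|uk].
have <- : f (jsrc k) = f (jsrc j) by rewrite -jk fj// mem_head.
by apply: IH kjs _ uk => l ljs; apply: fj; rewrite inE ljs orbT.
Qed.

Lemma sum_jtgt (m n : nat) (js : seq (jump m n)) (F : vertex m n -> int) :
  (m * n != 1)%N -> is_tour js ->
  \sum_(j <- js) F (jtgt j) = \sum_(j <- js) F (jsrc j).
Proof.
move=> mn1 tjs; have [_ psrc ptgt _] := tour_jumps mn1 tjs.
rewrite -(big_map (@jtgt m n) xpredT F) -(big_map (@jsrc m n) xpredT F).
by rewrite (perm_big _ ptgt) (perm_big _ psrc).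
Qed.

Lemma jumpP (m n : nat) (j : jump m n) : knight (jdir j).
Proof. by have /andP[] := valP j. Qed.

Lemma tour_rows (m n : nat) (js : seq (jump m n)) : (m * n != 1)%N -> is_tour js ->
  \sum_(j <- js) (jdir j).1 = 0.
Proof.
move=> mn1 tjs; have := sum_jtgt (fun v => (v.1 : nat)%:Z) mn1 tjs.
under eq_bigr do rewrite jtgt1E.
by rewrite big_split /= => /eqP; rewrite -subr_eq0 addrAC subrr add0r => /eqP.
Qed.

(** A knight pair has odd coordinate sum, and the row displacements of a closed tour add up to
    zero. *)
Lemma tour_parity (m n : nat) (js : seq (jump m n)) : (m * n != 1)%N -> is_tour js ->
  exists k : int, \sum_(j <- js) (jdir j).2 = (m * n)%N%:Z + 2 * k.
Proof.
move=> mn1 tjs; have [<- _ _ _] := tour_jumps mn1 tjs.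
suff [k kE] : exists k : int,
    \sum_(j <- js) ((jdir j).1 + (jdir j).2) = (size js)%:Z + 2 * k.
  by exists k; rewrite -kE big_split /= tour_rows// add0r.
elim: js {tjs} => [|j js [k kE]]; first by exists 0; rewrite big_nil.
have [l lE] : exists l : int, (jdir j).1 + (jdir j).2 = 1 + 2 * l.
  exists (((jdir j).1 + (jdir j).2 - 1) %/ 2)%Z.
  by have := jumpP j; rewrite /knight; lia.
by exists (k + l); rewrite big_cons kE lE /=; lia.
Qed.

(** Reduction modulo an even [n] preserves parity, so the chessboard colouring lives on the
    cylinder. *)
Lemma jtgt2_parity (m n : nat) (j : jump m n) : ~~ odd n ->
  odd (jtgt j).2 = odd (jsrc j).2 (+) odd `|(jdir j).2|.
Proof.
move=> en; have [k] := jtgt2E j.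
have nE : n%:Z = 2 * (n./2)%:Z by lia.
have -> : k * n%:Z = 2 * (k * (n./2)%:Z) by rewrite nE; ring.
by set q := k * _; lia.
Qed.

(** Within two rows a jump changes the row by one, hence the second coordinate by two; the parity of
    the latter would be an invariant separating [(0, 0)] from [(0, 1)]. *)
Lemma tour_not2 (n : nat) (js : seq (jump 2 n)) : (0 < n)%N -> ~~ odd n -> ~ is_tour js.
Proof.
move=> n0 en tjs; have n1 : (1 < n)%N by lia.
have mn1 : (2 * n != 1)%N by lia.
have [_ _ _ inv] := tour_jumps mn1 tjs.
suff same j : j \in js -> odd (jtgt j).2 = odd (jsrc j).2.
  by have := inv _ (fun v => odd v.2) same (ord0, Ordinal n0) (ord0, Ordinal n1).
move=> _; rewrite jtgt2_parity//.
have := jumpP j; have := jtgt1E j; have := ltn_ord (jtgt j).1; have := ltn_ord (jsrc j).1.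
by rewrite /knight; case: (odd (jsrc j).2); lia.
Qed.

Lemma tour_not4 (n : nat) (js : seq (jump 4 n)) : (0 < n)%N -> ~~ odd n -> ~ is_tour js.
Proof.
move=> n0 en tjs; have n1 : (1 < n)%N by lia.
have mn1 : (4 * n != 1)%N by lia.
have [js_size psrc _ inv] := tour_jumps mn1 tjs.
pose inner (v : vertex 4 n) : bool := (0 < v.1 < 3)%N.
(* Outer rows differ by [0] or [3], so no jump joins two outer vertices. *)
have inner_jump j : 0 <= (inner (jsrc j))%:Z + (inner (jtgt j))%:Z - 1.
  have := jumpP j; have := jtgt1E j.
  have := ltn_ord (jtgt j).1; have := ltn_ord (jsrc j).1.
  by rewrite /inner /knight; lia.
have inner_half : 2 * \sum_(j <- js) (inner (jsrc j))%:Z = (4 * n)%:Z.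
  rewrite -(big_map (@jsrc 4 n) xpredT (fun v => (inner v)%:Z)) (perm_big _ psrc) /=.
  rewrite big_enum /=.
  rewrite -(pair_big xpredT xpredT (fun (a : 'I_4) (b : 'I_n) => (inner (a, b))%:Z)) /=.
  by rewrite !big_ord_recl big_ord0 /inner /= !sumr_const !card_ord; lia.
(* Half of the sources and half of the targets are inner, so these nonnegative terms add up to zero
   and each one vanishes. *)
have alternate j : j \in js -> inner (jtgt j) = ~~ inner (jsrc j).
  have /eqP : \sum_(j <- js) ((inner (jsrc j))%:Z + (inner (jtgt j))%:Z - 1) = 0.
    rewrite sumrB big_split /= (sum_jtgt (fun v => (inner v)%:Z) mn1 tjs).
    rewrite -mulr2n -mulr_natl inner_half big_const_seq count_predT js_size.
    by rewrite iter_addr addr0 natz subrr.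
  rewrite psumr_eq0// => /allP sum0 /sum0 /= /eqP.
  by case: (inner (jtgt j)); case: (inner (jsrc j)).
(* Each jump of the tour flips both the colour and [inner], so their sum modulo two is invariant;
   yet [(0, 0)] and [(0, 1)] are both outer and of different colours. *)
suff same j : j \in js ->
    odd (jtgt j).1 (+) odd (jtgt j).2 (+) inner (jtgt j) =
    odd (jsrc j).1 (+) odd (jsrc j).2 (+) inner (jsrc j).
  by have := inv _ (fun v => odd v.1 (+) odd v.2 (+) inner v) same
    (ord0, Ordinal n0) (ord0, Ordinal n1).
move=> jjs; rewrite jtgt2_parity// alternate//.
have := jumpP j; have := jtgt1E j.
by rewrite /knight; case: (odd (jsrc j).2); case: (inner _); lia.
Qed.

Lemma generator_tour_admissible (R : realType) (m n : nat) : (0 < m)%N -> (0 < n)%N ->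
  supports_generator_tour R m n -> m \notin [:: 1; 2; 4]%N /\ ~~ (~~ odd m && odd n).
Proof.
move=> m0 n0 [js [tjs /(realizes_generatorP _ m0 n0 tjs) gen]].
have mn1 : (m * n != 1)%N.
  (* The constant tour has total rise [0], which differs from [n] and [-n]. *)
  apply/eqP => mn1; move: tjs gen; rewrite /is_tour mn1 eqxx => ->.
  by rewrite big_nil; lia.
have [js_size _ _ _] := tour_jumps mn1 tjs.
have par : ~~ (~~ odd m && odd n).
  have [k kE] := tour_parity mn1 tjs; rewrite kE in gen.
  apply/negP => /andP[em on].
  have mnE : (m * n)%N%:Z = 2 * (m./2 * n)%N%:Z by nia.
  by lia.
split=> //; rewrite !inE; apply/negP => /or3P[] /eqP mE; subst m.
(* Every jump changes the row, so a single row has none, but the tour has [n > 0] jumps. *)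
- case: js tjs js_size {gen par} => [|j js] _; first by rewrite mul1n /=; lia.
  have := jumpP j; have := jtgt1E j; have := ltn_ord (jtgt j).1; have := ltn_ord (jsrc j).1.
  by rewrite /knight; lia.
- by apply: (tour_not2 n0 _ tjs); move: par; rewrite andTb.
- by apply: (tour_not4 n0 _ tjs); move: par; rewrite andTb.
Qed.
End Obstruction.

Theorem theorem5p1 (R : realType) (m n : nat) (hm : 0 < m) (hn : 0 < n) :
  supports_generator_tour R m n <->
  ~ (m \in [:: 1; 2; 4]) /\ ~ (~~ odd m /\ odd n).
Proof.
split=> [/(generator_tour_admissible hm hn)[m124 mn]|[m124 mn]].
  by split; [exact/negP|move=> /andP; exact/negP].
by apply: supports_of_admissible => //; [exact/negP|apply/negP => /andP].
Qed.
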